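(* Let $n \ge 1$, let $a_1,\dots,a_n \in \mathbb{C}$ be distinct points, and let $X = \mathbb{C}\setminus\{a_1,\dots,a_n\}$. Let a homotopy class of continuous maps $X \to \mathbb{C}\times\mathbb{C}^*$ be given with associated winding numbers $k_j\in\mathbb{Z}$ about the punctures $a_j$, $j=1,\dots,n$. Suppose one of the following holds. (1) $k_j \neq 0$ for $j = 1,\dots,n$. (2) $n \ge 2$, with $k_n = 0$, $k_j\neq 0$ for $j = 1,\dots,n-1$, and $k_1 + \cdots+k_{n-1} \neq 0$. (3) $n \ge 3$, with $k_j = 0$ for $j = 3,\dots,n$, $k_1 = 1$, and $k_2 = -1$. (4) $n \ge 3$, with $k_j = 0$ for $j = 2,\dots,n$, and $k_1 = \pm 1$. Then the given homotopy class contains an embedding $X \to \mathbb{C}\times\mathbb{C}^*$.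
   Context: $\mathbb{C}^* = \mathbb{C}\setminus\{0\}$. The term embedding always means a proper injective holomorphic immersion. The winding number $k_j$ of a continuous map $X\to\mathbb{C}\times\mathbb{C}^*$ about the puncture $a_j$ is the winding number about $0$ of the image, under the $\mathbb{C}^*$-component of the map, of a small positively oriented circle around $a_j$ (enclosing no other puncture). Homotopy classes of continuous maps $X\to\mathbb{C}\times\mathbb{C}^*$ are in bijection with tuples $(k_1,\dots,k_n)\in\mathbb{Z}^n$ of winding numbers. *)

(* Defs.v *)
From HB Require Import structures.
From mathcomp Require Import all_boot all_order all_algebra.
From mathcomp Require Import complex.
From mathcomp Require Import all_classical all_reals all_analysis.
Import Order.TTheory GRing.Theory Num.Theory.
Import numFieldNormedType.Exports.

Set Implicit Arguments.
Unset Strict Implicit.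
Unset Printing Implicit Defensive.

Local Open Scope classical_set_scope.
Local Open Scope ring_scope.

(* [R[i]] as a one-dimensional normed module over itself: the library provides
   this structure on the regular module [R[i]^o] of any [numFieldType]; it is
   only transported here to [R[i]], so that its topology is the usual one. *)
HB.instance Definition _ (R : realType) := NormedModule.copy R[i] R[i]^o.

Definition Cstar (R : realType) : set R[i] := [set w | w != 0].

Definition CxCstar (R : realType) : set (R[i] * R[i]) := setT `*` @Cstar R.

Definition punctured_plane (R : realType) (n : nat) (a : 'I_n -> R[i]) :
  set R[i] := ~` range a.

(* Maps between subsets are represented by total functions, whose values outside
   of the domain are irrelevant. *)
Definition continuous_map (T U : topologicalType) (X : set T) (Y : set U)
    (f : T -> U) : Prop :=
  set_fun X Y f /\ {within X, continuous f}.

Definition homotopic (R : realType) (T U : topologicalType)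
    (X : set T) (Y : set U) (f g : T -> U) : Prop :=
  exists H : R * T -> U,
    [/\ continuous_map (`[(0 : R), 1] `*` X) Y H,
        (forall x, X x -> H (0, x) = f x) &
        (forall x, X x -> H (1, x) = g x)].

(* The winding number about 0 of a loop [gamma : [0, 1] -> C^*] is the net
   change over [0, 1], in turns, of a continuous choice [theta] of its argument. *)
Definition loop_winding (R : realType) (gamma : R -> R[i]) (m : int) : Prop :=
  exists theta : R -> R,
    [/\ {within `[0, 1], continuous theta},
        (forall t, t \in `[0, 1] ->
           gamma t = `|gamma t| * Complex (cos (theta t)) (sin (theta t))) &
        theta 1 - theta 0 = 2 * pi * m%:~R].

Definition circle (R : realType) (c : R[i]) (r t : R) : R[i] :=
  c + r%:C%C * Complex (cos (2 * pi * t)) (sin (2 * pi * t)).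

(* By homotopy invariance, the winding number does not depend on the radius [r]
   as long as the closed disc contains no other puncture. *)
Definition winding_about (R : realType) (n : nat) (a : 'I_n -> R[i])
    (f : R[i] -> R[i] * R[i]) (j : 'I_n) (m : int) : Prop :=
  exists r : R,
    [/\ 0 < r, (forall i, i != j -> r%:C%C < `|a i - a j|) &
        loop_winding (fun t => (f (circle (a j) r t)).2) m].

Definition proper_map (T U : topologicalType) (X : set T) (Y : set U)
    (f : T -> U) : Prop :=
  forall K : set U, compact K -> K `<=` Y -> compact (X `&` f @^-1` K).

Definition holomorphic (R : realType) (X : set R[i])
    (f : R[i] -> R[i] * R[i]) : Prop :=
  forall z, X z -> differentiable f z.

Definition embedding (R : realType) (X : set R[i]) (Y : set (R[i] * R[i]))
    (f : R[i] -> R[i] * R[i]) : Prop :=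
  [/\ set_fun X Y f,
      holomorphic X f,
      (forall z, X z -> injective ('d f z)),
      set_inj X f &
      proper_map X Y f].

(* Main.v *)
Require Import Defs.
From mathcomp Require Import all_boot all_order all_algebra.
From mathcomp Require Import complex.
From mathcomp Require Import all_classical all_reals all_analysis.
From mathcomp Require Import ring lra.
Import Order.TTheory GRing.Theory Num.Theory.
Import numFieldNormedType.Exports.
Import Normc.

(* The embedding is
     z |-> (eps z + \sum_(k_j = 0) (z - a_j)^-1, \prod_j (z - a_j)^(k_j))
   with eps = 1 or eps = 0. Its second component has the prescribed winding
   numbers and tends to 0 or to infinity at the punctures with k_j != 0, its
   first component has a pole at the other ones, and it is proper at infinity as
   soon as eps = 1 or \sum_j k_j != 0. In each of the four cases eps can be
   chosen so that z is a holomorphic function of one of the two components,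
   which makes the map an injective immersion.

   If the C^*-components of two maps have the same winding numbers, then their
   quotient g has a continuous logarithm l on X, and multiplication by
   exp ((1 - t) l) provides the homotopy. To construct l, pull g back by
   w |-> a_j + exp w: since the winding number of g about a_j is 0, a logarithm
   of the pull-back is 2 i pi-periodic, hence a logarithm of g on a punctured
   disc about a_j. After division by the exponentials of these local logarithms,
   cut off away from the punctures, g extends to a nonvanishing continuous
   function on C, which has a logarithm: write it as a product of ratios close
   to 1 along a subdivision of the segment from 0 to z. *)

Set Implicit Arguments.
Unset Strict Implicit.
Unset Printing Implicit Defensive.

Local Notation Re := complex.Re.
Local Notation Im := complex.Im.

Local Open Scope classical_set_scope.
Local Open Scope complex_scope.
Local Open Scope ring_scope.

(** * Topology of the complex plane *)

Lemma near_eq_continuous (T U : topologicalType) (f g : T -> U) (x : T) :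
  (\forall y \near x, f y = g y) -> {for x, continuous f} ->
  {for x, continuous g}.
Proof.
move=> fg cf; have fgx := nbhs_singleton fg.
by rewrite /prop_for /continuous_at -fgx; exact: cvg_trans (near_eq_cvg fg) cf.
Qed.

Lemma fst_continuous (T U : topologicalType) (p : T * U) :
  {for p, continuous (@fst T U)}.
Proof. exact: cvg_fst. Qed.

Lemma snd_continuous (T U : topologicalType) (p : T * U) :
  {for p, continuous (@snd T U)}.
Proof. exact: cvg_snd. Qed.

Section ComplexTopology.
Variable R : realType.
Implicit Types (z w c : R[i]) (x y : R).

Lemma gt0_complexE z : 0 < z -> exists2 e : R, 0 < e & z = e%:C.
Proof.
case: z => x y; rewrite ltcE /= => /andP[/eqP-> x0].
by exists x.
Qed.

Lemma normcB_sym z w : normc (z - w) = normc (w - z).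
Proof. by rewrite -normcN opprB. Qed.

Lemma ler_normc_Re z : `|Re z| <= normc z.
Proof. by rewrite -lecR; exact: normc_ge_Re. Qed.

Lemma ler_normc_Im z : `|Im z| <= normc z.
Proof.
have -> : `|Im z| = `|Re ('i * z)| by rewrite mulrC ReiNIm normrN.
apply: le_trans (ler_normc_Re _) _.
by rewrite normcM /= expr0n expr1n add0r sqrtr1 mul1r.
Qed.

(** The norm of [R[i]] takes its values in [R[i]], where a positive element is a positive real.
    Limits can thus be tested with the real-valued modulus [normc]. *)
Lemma cvg_complexP (T : Type) (F : set_system T) {FF : Filter F}
    (f : T -> R[i]) z :
  f @ F --> z <-> forall e : R, 0 < e -> \forall t \near F, normc (z - f t) < e.
Proof.
split=> [/cvgrPdist_lt h e e0|h].
  by have := h e%:C; rewrite ltcR => /(_ e0); under eq_near do rewrite ltcR.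
apply/cvgrPdist_lt => _ /gt0_complexE[e e0 ->].
by under eq_near do rewrite ltcR; exact: h.
Qed.

Lemma near_normc z (e : R) : 0 < e -> \forall w \near z, normc (z - w) < e.
Proof. exact: (@cvg_complexP _ (nbhs z) _ id z).1. Qed.

Lemma continuous_Re : continuous (@complex.Re R).
Proof.
move=> z; apply/(@cvgrPdist_lt _ _ _ (nbhs z)) => e e0; near=> w.
rewrite -raddfB; apply: le_lt_trans (ler_normc_Re _) _.
by near: w; exact: near_normc.
Unshelve. all: by end_near. Qed.

Lemma continuous_Im : continuous (@complex.Im R).
Proof.
move=> z; apply/(@cvgrPdist_lt _ _ _ (nbhs z)) => e e0; near=> w.
rewrite -raddfB; apply: le_lt_trans (ler_normc_Im _) _.
by near: w; exact: near_normc.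
Unshelve. all: by end_near. Qed.

Lemma continuous_real_complex : continuous (real_complex R).
Proof.
move=> x; apply/cvg_complexP => e e0; near=> y.
rewrite -rmorphB /= expr0n addr0 sqrtr_sqr.
near: y; move: e e0; apply/cvgrPdist_lt; exact: cvg_id.
Unshelve. all: by end_near. Qed.

Lemma continuous_normc : continuous (@normc R).
Proof.
move=> z; have := @norm_continuous R[i] R[i] z.
by move=> /(continuous_comp (g := @complex.Re R)); apply; exact: continuous_Re.
Qed.

Section Local.
Variables (T : topologicalType) (t : T).

Lemma continuous_fctD (f g : T -> R[i]) :
  {for t, continuous f} -> {for t, continuous g} ->
  {for t, continuous (fun s => f s + g s)}.
Proof. exact: continuousD. Qed.

Lemma continuous_fctN (f : T -> R[i]) :
  {for t, continuous f} -> {for t, continuous (fun s => - f s)}.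
Proof. exact: continuousN. Qed.

Lemma continuous_fctM (f g : T -> R[i]) :
  {for t, continuous f} -> {for t, continuous g} ->
  {for t, continuous (fun s => f s * g s)}.
Proof. exact: continuousM. Qed.

Lemma continuous_fctV (f : T -> R[i]) :
  f t != 0 -> {for t, continuous f} -> {for t, continuous (fun s => (f s)^-1)}.
Proof. exact: continuousV. Qed.

Lemma continuous_Complex (f g : T -> R) :
  {for t, continuous f} -> {for t, continuous g} ->
  {for t, continuous (fun s => f s +i* g s)}.
Proof.
move=> cf cg.
have -> : (fun s => f s +i* g s) = (fun s => (f s)%:C + 'i * (g s)%:C).
  by apply/funext => s; rewrite [LHS]complexE.
apply: continuous_fctD; last apply: continuous_fctM.
- exact: (continuous_comp cf (@continuous_real_complex _)).
- exact: cst_continuous.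
- exact: (continuous_comp cg (@continuous_real_complex _)).
Qed.

Lemma continuous_sum (I : Type) (s : seq I) (P : pred I) (f : I -> T -> R[i]) :
  (forall i, P i -> {for t, continuous (f i)}) ->
  {for t, continuous (fun u => \sum_(i <- s | P i) f i u)}.
Proof. by move=> h; apply: cvg_big => //; exact: add_continuous. Qed.

Lemma continuous_prod (I : Type) (s : seq I) (P : pred I) (f : I -> T -> R[i]) :
  (forall i, P i -> {for t, continuous (f i)}) ->
  {for t, continuous (fun u => \prod_(i <- s | P i) f i u)}.
Proof. by move=> h; apply: cvg_big => //; exact: mul_continuous. Qed.

Lemma continuous_exprn (f : T -> R[i]) n :
  {for t, continuous f} -> {for t, continuous (fun s => f s ^+ n)}.
Proof.
move=> cf; elim: n => [|n IHn]; first exact: cst_continuous.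
under [X in {for t, continuous X}]eq_fun do rewrite exprS.
exact: continuous_fctM.
Qed.

Lemma continuous_exprz (f : T -> R[i]) (k : int) :
  {for t, continuous f} -> f t != 0 -> {for t, continuous (fun s => f s ^ k)}.
Proof.
move=> cf f0; case: k => n; first exact: continuous_exprn.
by apply: continuous_fctV; [rewrite expf_neq0|exact: continuous_exprn].
Qed.

End Local.

Lemma continuous_addr c z : {for z, continuous (fun w : R[i] => w + c)}.
Proof.
have cid : {for z, continuous (fun w : R[i] => w)} by exact: cvg_id.
exact: continuous_fctD cid (@cst_continuous _ _ c _).
Qed.

Lemma compact_rectangle (a b c d : R) :
  compact [set z : R[i] | a <= Re z <= b /\ c <= Im z <= d].
Proof.
pose F (p : R * R) := p.1 +i* p.2.
have -> : [set z : R[i] | a <= Re z <= b /\ c <= Im z <= d] =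
    F @` (`[a, b] `*` `[c, d]).
  apply/seteqP; split => [[x y]/= [xab ycd]|_ [[x y] /= [xab ycd] <-]].
    by exists (x, y) => //=; rewrite !in_itv.
  by move: xab ycd; rewrite !in_itv.
apply: continuous_compact.
  apply: continuous_subspaceT => p.
  by apply: continuous_Complex; [exact: cvg_fst|exact: cvg_snd].
by apply: compact_setX; exact: segment_compact.
Qed.

Lemma closed_bounded_compact (A : set R[i]) (M : R) :
  closed A -> (forall z, A z -> normc z <= M) -> compact A.
Proof.
move=> clA bA;
  apply: subclosed_compact clA (@compact_rectangle (- M) M (- M) M) _.
move=> z /bA zM; rewrite /= -!ler_norml.
by split; apply: le_trans zM; [exact: ler_normc_Re|exact: ler_normc_Im].
Qed.

End ComplexTopology.

(** * Complex exponential and logarithm *)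

Section ComplexExponential.
Variable R : realType.
Implicit Types (z w : R[i]) (x y : R).

Definition cis x : R[i] := cos x +i* sin x.

Definition cexp z : R[i] := (expR (Re z))%:C * cis (Im z).

Lemma cisD x y : cis (x + y) = cis x * cis y.
Proof. by rewrite /cis cosD sinD [LHS]/= [RHS]/=; congr Complex; ring. Qed.

Lemma cis0 : cis 0 = 1.
Proof. by rewrite /cis cos0 sin0. Qed.

Lemma normc_cis x : normc (cis x) = 1.
Proof. by rewrite /= cos2Dsin2 sqrtr1. Qed.

Lemma cis_neq0 x : cis x != 0.
Proof.
apply/eqP => /(congr1 (@normc R)); rewrite normc_cis normc0 => /eqP.
by rewrite oner_eq0.
Qed.

Lemma cisN x : cis (- x) = (cis x)^-1.
Proof.
by apply: (mulIf (cis_neq0 x)); rewrite -cisD addNr cis0 mulVf ?cis_neq0.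
Qed.

Lemma cis2pi : cis (2 * pi) = 1.
Proof. by rewrite /cis mulr_natl cos2pi sin2pi. Qed.

Lemma cexpD z w : cexp (z + w) = cexp z * cexp w.
Proof. by rewrite /cexp !raddfD /= expRD rmorphM cisD /=; ring. Qed.

Lemma cexp0 : cexp 0 = 1.
Proof. by rewrite /cexp /= expR0 cis0 mulr1. Qed.

Lemma normc_cexp z : normc (cexp z) = expR (Re z).
Proof.
rewrite normcM normc_cis mulr1 /= expr0n addr0 sqrtr_sqr ger0_norm // expR_ge0.
Qed.

Lemma cexp_neq0 z : cexp z != 0.
Proof.
apply/eqP => /(congr1 (@normc R)); rewrite normc_cexp normc0 => /eqP.
by rewrite gt_eqF ?expR_gt0.
Qed.

Lemma cexpN z : cexp (- z) = (cexp z)^-1.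
Proof.
by apply: (mulIf (cexp_neq0 z)); rewrite -cexpD addNr cexp0 mulVf ?cexp_neq0.
Qed.

Lemma cexp_sum (I : Type) (s : seq I) (P : pred I) (f : I -> R[i]) :
  cexp (\sum_(i <- s | P i) f i) = \prod_(i <- s | P i) cexp (f i).
Proof. exact: (big_morph cexp cexpD cexp0). Qed.

Lemma continuous_cis : continuous cis.
Proof.
by move=> x; apply: continuous_Complex;
  [exact: continuous_cos|exact: continuous_sin].
Qed.

Lemma continuous_cexp : continuous cexp.
Proof.
move=> z.
apply: (@continuous_fctM _ _ z (fun w => (expR (Re w))%:C)
  (cis \o @complex.Im R)).
  apply: (@continuous_comp _ _ _ (expR \o @complex.Re R) (real_complex R)).
    by apply: continuous_comp; [exact: continuous_Re|exact: continuous_expR].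
  exact: continuous_real_complex.
by apply: continuous_comp; [exact: continuous_Im|exact: continuous_cis].
Qed.

(* The principal logarithm on the right half-plane, junk elsewhere. *)
Definition clog w : R[i] := ln (normc w) +i* atan (Im w / Re w).

Lemma normc_gt0 w : (0 < normc w) = (w != 0).
Proof. by rewrite -ltcR -(normr_gt0 w). Qed.

Lemma clogK w : 0 < Re w -> cexp (clog w) = w.
Proof.
case: w => x y /= x0; rewrite /cexp /clog lnK; last first.
  by rewrite posrE normc_gt0 eq_complex /= gt_eqF.
set t := atan _.
have ct0 : cos t != 0.
  by rewrite gt_eqF // cos_gt0_pihalf // atan_gtNpi2 atan_ltpi2.
have st : sin t = y / x * cos t by rewrite -[y / x]atanK -/t /tan divfK.
(* Since [x > 0], [cos (atan (y / x)) = x / normc w]; the imaginary part then follows from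
   [sin t = y / x * cos t]. *)
have ct : normc (x +i* y) * cos t = x.
  rewrite cos_atan /=.
  have -> : x ^+ 2 + y ^+ 2 = x ^+ 2 * (1 + (y / x) ^+ 2).
    by field; rewrite gt_eqF.
  rewrite sqrtrM ?sqr_ge0 // sqrtr_sqr gtr0_norm // mulfK // gt_eqF //
    sqrtr_gt0.
  by rewrite ltr_pwDl ?sqr_ge0.
rewrite /cis st; simpc; rewrite ct mulrCA ct divfK // gt_eqF //.
Qed.

Lemma continuous_clog w : 0 < Re w -> {for w, continuous clog}.
Proof.
move=> w0; apply: continuous_Complex.
  apply: (continuous_comp (@continuous_normc R w)); apply: continuous_ln.
  by rewrite normc_gt0; apply/eqP => w00; rewrite w00 ltxx in w0.
apply: (@continuous_comp _ _ _ (fun z => Im z / Re z) (@atan R)); last first.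
  exact: continuous_atan.
apply: (@continuousM R _ (@complex.Im R) (fun z => (Re z)^-1)).
  exact: continuous_Im.
by apply: (@continuousV R); [rewrite gt_eqF|exact: continuous_Re].
Qed.

Lemma clog1 : clog 1 = 0.
Proof. by rewrite /clog normc1 ln1 mul0r atan0. Qed.

Lemma cexp_cis x : cexp (0 +i* x) = cis x.
Proof. by rewrite /cexp /= expR0 mul1r. Qed.

Lemma cexp_surj w : w != 0 -> exists z, cexp z = w.
Proof.
move=> w0.
(* Some rotation by a multiple of [pi / 2] brings [w] into the right half-plane, where [clog]
   inverts [cexp]. *)
suff [x wx] : exists x, 0 < Re (cis x * w).
  exists (clog (cis x * w) - (0 +i* x)).
  by rewrite cexpD cexpN cexp_cis clogK // mulrC mulKf ?cis_neq0.
case: w w0 => a b; rewrite eq_complex /= negb_and.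
have [a0|a0|->] := ltgtP a 0.
- by exists pi; rewrite /cis cospi sinpi; lra.
- by exists 0; rewrite /cis cos0 sin0; lra.
rewrite /=; have [b0|b0|//] := ltgtP b 0 => _.
- by exists (pi / 2); rewrite cos_pihalf sin_pihalf; lra.
- by exists (- (pi / 2)); rewrite cosN sinN cos_pihalf sin_pihalf; lra.
Qed.

(* [phi 0 + min (pi, (phi 1 - phi 0) / 2)] would be a value of [phi] between two
   consecutive multiples of [2 pi]. *)
Lemma cis_eq1_const (phi : R -> R) : {within `[0, 1], continuous phi} ->
  (forall t, t \in `[0, 1] -> cis (phi t) = 1) -> phi 0 = phi 1.
Proof.
move=> cphi phi1.
wlog lt01 : phi cphi phi1 / phi 0 < phi 1.
  move=> H; have [lt01|lt10|//] := ltgtP (phi 0) (phi 1); first exact: H.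
  apply: oppr_inj; apply: (H (fun t => - phi t)); last by rewrite ltrN2.
    by move=> t; apply: continuousN; exact: cphi.
  by move=> t t01; rewrite cisN phi1 // invr1.
set e := Num.min pi ((phi 1 - phi 0) / 2).
have e0 : 0 < e by rewrite lt_min pi_gt0 /=; lra.
have epi : e <= pi by rewrite ge_min lexx.
have ephi : e <= (phi 1 - phi 0) / 2 by rewrite ge_min lexx orbT.
have [|c c01 ce] := @IVT _ phi 0 1 (phi 0 + e) ler01 cphi.
  rewrite ge_min le_max; apply/andP; split; apply/orP; [left|right]; lra.
have : cis e = 1.
  have -> : e = phi c - phi 0 by rewrite ce; lra.
  by rewrite cisD cisN !phi1 ?invr1 ?mulr1 // in_itv /= lexx ler01.
case=> cose _; suff : cos e < cos 0 by rewrite cos0 cose ltxx.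
by rewrite ltr_cos // in_itv /= ?lexx ?pi_ge0 // epi ltW.
Qed.

(** Comparing moduli makes [phi] purely imaginary, which reduces the claim to [cis_eq1_const].
    Applied to the difference of two logarithms along a path, it carries equality from one end to
    the other. *)
Lemma cexp_eq1_const (phi : R -> R[i]) : {within `[0, 1], continuous phi} ->
  (forall t, t \in `[0, 1] -> cexp (phi t) = 1) -> phi 0 = phi 1.
Proof.
move=> cphi phi1.
have Re0 t : t \in `[0, 1] -> Re (phi t) = 0.
  move=> /phi1 /(congr1 (@normc R)); rewrite normc_cexp normc1 => h.
  by rewrite -[LHS]expRK h ln1.
have I0 : 0 \in `[(0 : R), 1] by rewrite in_itv /= lexx ler01.
have I1 : 1 \in `[(0 : R), 1] by rewrite in_itv /= lexx ler01.
apply/eqP; rewrite eq_complex !Re0 // eqxx /=; apply/eqP.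
apply: (@cis_eq1_const (fun t => Im (phi t))) => [t|t t01].
  by apply: continuous_comp; [exact: cphi|exact: continuous_Im].
by rewrite -[RHS](phi1 t t01) /cexp Re0 // expR0 mul1r.
Qed.

Lemma cisMz x (m : int) : cis (m%:~R * x) = cis x ^ m.
Proof.
have cisMn n : cis (n%:R * x) = cis x ^+ n.
  elim: n => [|n IHn]; first by rewrite mul0r cis0.
  by rewrite -addn1 natrD mulrDl mul1r cisD IHn exprD expr1.
by case: m => n; rewrite ?NegzE ?mulrNz ?mulNr ?cisN ?exprSzr -?pmulrn cisMn.
Qed.

Lemma cis_eq1 x : cis x = 1 -> exists m : int, x = 2 * pi * m%:~R.
Proof.
move=> x1; have pi0 : 0 < pi :> R := pi_gt0 R.
pose m := Num.floor (x / (2 * pi)); exists m.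
have /andP[mx xm] := Num.Theory.floor_itv (x / (2 * pi)).
rewrite -/m ler_pdivlMr in mx; last lra.
rewrite -/m ltr_pdivrMr in xm; last lra.
rewrite intrD in xm.
(* The remainder of [x] modulo [2 * pi] lies in [[0, 2 * pi)] and still has [cis e = 1]; it must be
   shown to be 0. *)
set e := x - m%:~R * (2 * pi).
have [e0 e2] : 0 <= e /\ e < 2 * pi by split; rewrite /e; lra.
have [cose _] : cis e = 1.
  by rewrite /e cisD cisN cisMz cis2pi exp1rz x1 invr1 mulr1.
suff : e = 0 by rewrite /e; lra.
apply: le_anti; rewrite e0 andbT leNgt; apply/negP => egt0.
(* [cos] is strictly decreasing on [[0, pi]]; beyond [pi], the reflection [2 * pi - e] brings the
   angle back there. *)
have [epi|epi] := leP e pi.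
  suff : cos e < cos 0 by rewrite cos0 cose ltxx.
  by rewrite ltr_cos // in_itv /= ?lexx ?pi_ge0 // e0.
suff : cos (2 * pi - e) < cos 0.
  rewrite cos0 cosB; have [-> ->] := cis2pi.
  by rewrite mul1r mul0r addr0 cose ltxx.
have pie : 0 <= 2 * pi - e <= pi by apply/andP; split; lra.
by rewrite ltr_cos ?in_itv /= ?lexx ?pi_ge0 //; lra.
Qed.

Lemma cexp_eq1 z : cexp z = 1 -> exists m : int, z = 0 +i* (2 * pi * m%:~R).
Proof.
case: z => x y xy1.
have x0 : x = 0.
  have /(congr1 (@normc R)) := xy1; rewrite normc_cexp normc1 /= => h.
  by rewrite -[LHS]expRK h ln1.
move: xy1; rewrite x0 cexp_cis => /cis_eq1[m ->]; by exists m.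
Qed.

End ComplexExponential.

(** * Continuous logarithms of nonvanishing functions on the whole plane *)

Section ContinuousLogarithm.
Variable R : realType.
Implicit Types (z w : R[i]) (x y : R).

Lemma normc_real x : normc x%:C = `|x|.
Proof. by rewrite /= expr0n addr0 sqrtr_sqr. Qed.

Lemma normc_ge0 z : 0 <= normc z.
Proof. by rewrite -lecR; exact: (normr_ge0 z). Qed.

Lemma closed_disc (M : R) : closed [set z : R[i] | normc z <= M].
Proof.
have -> : [set z : R[i] | normc z <= M] = @normc R @^-1` [set x | x <= M] by [].
by apply: closed_comp; [move=> z _; exact: continuous_normc|exact: closed_le].
Qed.

Lemma compact_disc (M : R) : compact [set z : R[i] | normc z <= M].
Proof. by apply: (closed_bounded_compact (M := M) (@closed_disc M)). Qed.

(** The ratio [g w / g z] is continuous and equals 1 on the diagonal; compactness of the disc makes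
    the size of the neighbourhood uniform. It keeps the ratios in the half-plane where [clog] is a
    continuous logarithm. *)
Lemma near_ratio_Re_gt0 (g : R[i] -> R[i]) (M : R) :
    (forall z, {for z, continuous g}) -> (forall z, g z != 0) ->
  exists2 d : R, 0 < d & forall z w, normc z <= M -> normc (z - w) < d ->
    0 < Re (g w / g z).
Proof.
move=> cg g0.
have /compact_near_coveringP cov := @compact_disc M.
have near_z0 z0 : normc z0 <= M -> \forall z \near z0 & d \near (0 : R)^'+,
    forall w, normc (z - w) < d -> 0 < Re (g w / g z).
  move=> _.
  have [e e0 He] : exists2 e : R, 0 < e & forall z w, normc (z0 - z) < e ->
      normc (z0 - w) < e -> 0 < Re (g w / g z).
    have c : {for (z0, z0), continuous (fun p : R[i] * R[i] =>
      Re (g p.2 / g p.1))}.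
      apply: (@continuous_comp _ _ _ (fun p : R[i] * R[i] => g p.2 / g p.1)
        (@complex.Re R)); last exact: continuous_Re.
      apply: continuous_fctM; last apply: continuous_fctV => //.
        by apply: continuous_comp; [exact: cvg_snd|exact: cg].
      by apply: continuous_comp; [exact: cvg_fst|exact: cg].
    have : \forall p \near (z0, z0), 0 < Re (g p.2 / g p.1).
      by apply: (cvgr_gt _ c); rewrite /= divff //= ltr01.
    move=> [[A B] [/= nA nB] AB].
    have /nbhs_normP[_ /gt0_complexE[e e0 ->] eAB] : nbhs z0 (A `&` B).
      exact: filterI.
    exists e => // z w ze we; apply: (AB (z, w)); split => /=.
      by apply: (eAB z _).1; rewrite /= ltcR.
    by apply: (eAB w _).2; rewrite /= ltcR.
  (* With both distances below [e / 2], the point [w] is still within [e] of [z0]. *)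
  exists ([set z | normc (z0 - z) < e / 2], [set d | d < e / 2]).
    by split => /=; [apply: near_normc; lra|apply: nbhs_right_lt; lra].
  move=> [z d] /= [z0z de] w zw; apply: He.
    by apply: (lt_le_trans z0z); lra.
  have -> : z0 - w = (z0 - z) + (z - w) by ring.
  apply: le_lt_trans (le_normcD _ _) _; rewrite (splitr e) ltrD //.
  exact: lt_trans de.
have d_near := cov R (0^'+)
  (fun d z => forall w, normc (z - w) < d -> 0 < Re (g w / g z)) _ near_z0.
have [d [d0 dP]] := filter_ex (filterI (nbhs_right_gt (0 : R)) (d_near _)).
by exists d => // z w zM; exact: dP.
Qed.

(** The principal logarithms of the ratios of [g] at consecutive points [k z / N] add up to a
    logarithm of [g z / g 0], by telescoping. Prescribing [h 0 = c] lets the logarithms on different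
    discs be glued. *)
Lemma disc_logarithm (g : R[i] -> R[i]) (c : R[i]) (M : R) :
    (forall z, {for z, continuous g}) -> (forall z, g z != 0) ->
    cexp c = g 0 ->
  exists h : R[i] -> R[i], [/\ h 0 = c,
    (forall z, normc z < M -> {for z, continuous h}) &
    (forall z, normc z < M -> g z = cexp (h z))].
Proof.
move=> cg g0 cE.
have [d d0 dP] := near_ratio_Re_gt0 M cg g0.
(* [N] is large enough for consecutive subdivision points to be at distance less than [d]. *)
pose N := (Num.trunc (M / d)).+1.
have N0 : 0 < N%:R :> R by rewrite ltr0n.
have MN : M < N%:R * d by rewrite -ltr_pdivrMr // truncnS_gt.
pose p k z := (k%:R / N%:R)%:C * z.
pose q k z := g (p k.+1 z) / g (p k z).
have q_gt0 k z : (k < N)%N -> normc z < M -> 0 < Re (q k z).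
  move=> kN zM; apply: dP.
    rewrite /p normcM normc_real ger0_norm ?divr_ge0 ?ler0n //.
    apply: le_trans (ltW zM); rewrite ler_piMl ?normc_ge0 //.
    by rewrite ler_pdivrMr // mul1r ler_nat ltnW.
  rewrite normcB_sym /p -mulrBl -rmorphB normcM normc_real -mulrBl -natrB //.
  rewrite subSnn mul1r ger0_norm ?invr_ge0 ?ler0n // ltr_pdivrMl //.
  exact: lt_trans MN.
have cp k : continuous (p k) by move=> z; exact: mulrl_continuous.
exists (fun z => c + \sum_(0 <= k < N) clog (q k z)); split.
- rewrite big1 ?addr0 // => k _.
  by rewrite /q /p !mulr0 divff // clog1.
- move=> z zM; apply: continuous_fctD; first exact: cst_continuous.
  under [X in {for z, continuous X}]eq_fun do rewrite big_mkord.
  apply: continuous_sum => k _.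
  apply: (@continuous_comp _ _ _ (q k) (@clog R)); last first.
    by apply: continuous_clog; exact: q_gt0.
  have cgp j : {for z, continuous (g \o p j)}.
    by apply: continuous_comp; [exact: cp|exact: cg].
  have cVgp : {for z, continuous (fun w => (g (p k w))^-1)}.
    by have := continuous_fctV _ (cgp k); apply; exact: g0.
  have := continuous_fctM (cgp k.+1) cVgp.
  exact.
- move=> z zM; rewrite cexpD cexp_sum cE.
  have -> : \prod_(0 <= k < N) cexp (clog (q k z)) =
      \prod_(0 <= k < N) (g (p k.+1 z) / g (p k z)).
    by rewrite !big_mkord; apply: eq_bigr => k _; rewrite clogK // q_gt0.
  rewrite telescope_prodf // /p mul0r mul0r divff ?gt_eqF // mul1r.
  by rewrite mulrC divfK.
Qed.

(** The difference of the two logarithms has exponential 1 along the segment from 0 to [z], and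
    vanishes at 0. *)
Lemma logarithm_unique (g h h' : R[i] -> R[i]) (M : R) :
    h 0 = h' 0 ->
    (forall z, normc z < M -> {for z, continuous h}) ->
    (forall z, normc z < M -> {for z, continuous h'}) ->
    (forall z, normc z < M -> g z = cexp (h z)) ->
    (forall z, normc z < M -> g z = cexp (h' z)) ->
  forall z, normc z < M -> h z = h' z.
Proof.
move=> h0 ch ch' hg hg' z zM.
have tzM t : t \in `[0, 1] -> normc (t%:C * z) < M.
  rewrite in_itv /= => /andP[t0 t1]; apply: le_lt_trans zM.
  by rewrite normcM normc_real ger0_norm // ler_piMl ?normc_ge0.
have ct : continuous (fun t : R => t%:C * z).
  move=> t; apply: continuous_fctM; last exact: cst_continuous.
  exact: continuous_real_complex.
pose phi t := h (t%:C * z) - h' (t%:C * z).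
suff : phi 0 = phi 1.
  rewrite /phi mul0r h0 subrr mul1r => /eqP.
  by rewrite eq_sym subr_eq0 => /eqP.
apply: cexp_eq1_const => [|t t01].
  apply: continuous_in_subspaceT => t; rewrite inE => /= t01.
  have c1 : {for t, continuous (fun s : R => h (s%:C * z))}.
    by apply: continuous_comp; [exact: ct|exact/ch/tzM].
  have c2 : {for t, continuous (fun s : R => h' (s%:C * z))}.
    by apply: continuous_comp; [exact: ct|exact/ch'/tzM].
  exact: continuous_fctD c1 (continuous_fctN c2).
by rewrite cexpD cexpN -hg -?hg' ?divff ?tzM // (hg _ (tzM _ t01)) cexp_neq0.
Qed.

(** Logarithms on the discs of integer radius with a common value at 0 agree on overlaps; at [z],
    the disc of radius [m z] is used, which contains [z]. *)
Lemma continuous_logarithm (g : R[i] -> R[i]) :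
    (forall z, {for z, continuous g}) -> (forall z, g z != 0) ->
  exists2 h : R[i] -> R[i], (forall z, {for z, continuous h}) &
    (forall z, g z = cexp (h z)).
Proof.
move=> cg g0; have [c cE] := cexp_surj (g0 0).
have [h hP] := choice (fun M : nat => disc_logarithm M%:R cg g0 cE).
pose m z := (Num.trunc (normc z)).+1.
have mP z : normc z < (m z)%:R by rewrite truncnS_gt.
have hE (M : nat) z : normc z < M%:R -> h (m z) z = h M z.
  have [h0 ch gh] := hP (m z); have [h0' ch' gh'] := hP M.
  move=> zM.
  apply: (@logarithm_unique g _ _ (Num.min M%:R (m z)%:R)).
  - by rewrite h0 h0'.
  - by move=> w; rewrite lt_min => /andP[_]; exact: ch.
  - by move=> w; rewrite lt_min => /andP[+ _]; exact: ch'.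
  - by move=> w; rewrite lt_min => /andP[_]; exact: gh.
  - by move=> w; rewrite lt_min => /andP[+ _]; exact: gh'.
  - by rewrite lt_min zM mP.
exists (fun z => h (m z) z) => z; have [_ ch gh] := hP (m z); last exact: gh.
(* The radius [m w] may jump near [z], but nearby points still lie in the disc of radius [m z],
   where both choices agree. *)
have near_h : \forall w \near z, h (m z) w = h (m w) w.
  near=> w; rewrite (hE (m z)) //; near: w.
  by apply: (cvgr_lt _ (@continuous_normc R z)); exact: mP.
exact: near_eq_continuous near_h (ch _ (mP _)).
Unshelve. all: by end_near. Qed.
End ContinuousLogarithm.

(** * Winding numbers *)

Section Winding.
Variable R : realType.
Implicit Types (z w c : R[i]) (gamma : R -> R[i]).

Lemma eq_loop_winding gamma gamma' (m : int) :
  (forall t, t \in `[0, 1] -> gamma t = gamma' t) ->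
  loop_winding gamma m -> loop_winding gamma' m.
Proof.
move=> e [th [cth thE th01]]; exists th; split=> // t t01.
by rewrite -e //; exact: thE.
Qed.

Lemma loop_windingM gamma gamma' (m m' : int) :
  loop_winding gamma m -> loop_winding gamma' m' ->
  loop_winding (fun t => gamma t * gamma' t) (m + m').
Proof.
move=> [th [cth thE th01]] [th' [cth' thE' th01']].
exists (fun t => th t + th' t); split.
- by move=> t; apply: continuousD; [exact: cth|exact: cth'].
- move=> t t01; rewrite normrM -/(cis _) cisD.
  by rewrite mulrACA -thE // -thE'.
- by rewrite intrD mulrDr -th01 -th01'; ring.
Qed.

Lemma loop_windingV gamma (m : int) :
  loop_winding gamma m -> loop_winding (fun t => (gamma t)^-1) (- m).
Proof.
move=> [th [cth thE th01]]; exists (fun t => - th t); split.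
- by move=> t; apply: continuousN; exact: cth.
- by move=> t t01; rewrite normfV -/(cis _) cisN -invfM -thE.
- by rewrite mulrNz mulrN -th01; ring.
Qed.

Lemma loop_winding0 : loop_winding (fun=> 1 : R[i]) 0.
Proof.
exists (fun=> 0); split.
- by apply: continuous_subspaceT => t; exact: cst_continuous.
- by move=> t _; rewrite normr1 mul1r -/(cis _) cis0.
- by rewrite mulr0 subrr.
Qed.

Lemma loop_windingX gamma (m k : int) :
  loop_winding gamma m -> loop_winding (fun t => gamma t ^ k) (m * k).
Proof.
move=> wg.
have wX n : loop_winding (fun t => gamma t ^+ n) (m * n%:Z).
  elim: n => [|n IHn]; first by rewrite mulr0; exact: loop_winding0.
  rewrite -addn1 PoszD mulrDr mulr1;
    apply: eq_loop_winding (loop_windingM IHn wg).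
  by move=> t _; rewrite addn1 exprSr.
case: k => n; first exact: wX.
by rewrite NegzE mulrN; exact: loop_windingV.
Qed.

(** The quotient of the loop by itself is constantly 1 and has winding number [m - m']; a continuous
    argument of 1 takes the same value at both ends. *)
Lemma loop_winding_unique gamma (m m' : int) :
  (forall t, t \in `[0, 1] -> gamma t != 0) ->
  loop_winding gamma m -> loop_winding gamma m' -> m = m'.
Proof.
move=> g0 wg wg'.
have [th [cth thE th01]] := loop_windingM wg (loop_windingV wg').
apply/eqP; rewrite -subr_eq0 -(intr_eq0 R); apply/eqP.
suff th1 : th 0 = th 1.
  apply: (mulfI (_ : 2 * pi != 0)); last by rewrite mulr0 -th01 th1 subrr.
  by rewrite mulf_neq0 ?pnatr_eq0 // gt_eqF // pi_gt0.
apply: cis_eq1_const => // t t01.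
by have := thE _ t01; rewrite divff ?g0 // normr1 mul1r.
Qed.

Lemma loop_winding_circle c (r : R) : 0 < r ->
  loop_winding (fun t => circle c r t - c) 1.
Proof.
move=> r0; exists (fun t => 2 * pi * t); split.
- by apply: continuous_subspaceT => t; exact: mulrl_continuous.
- move=> t _; rewrite /circle addrC addKr -/(cis _) normrM.
  by rewrite -[`|cis _|]/((normc (cis _))%:C) normc_cis mulr1 ger0_norm // lecR
    ltW.
- by rewrite mulr0 subr0.
Qed.

Lemma loop_winding_cexp (L : R -> R[i]) (m : int) :
  {within `[0, 1], continuous L} -> Im (L 1) - Im (L 0) = 2 * pi * m%:~R ->
  loop_winding (fun t => cexp (L t)) m.
Proof.
move=> cL L01; exists (fun t => Im (L t)); split => //.
  by move=> t; apply: continuous_comp; [exact: cL|exact: continuous_Im].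
by move=> t _; rewrite -[`|_|]/((normc (cexp _))%:C) normc_cexp.
Qed.

(** A mere choice of logarithms, without continuity; continuity is recovered below by composing with
    a periodic function. *)
Lemma cexp_log_exists : exists f : R[i] -> R[i], forall w,
  w != 0 -> cexp (f w) = w.
Proof.
have /choice[f fP] : forall w, exists u, w != 0 -> cexp u = w; last by exists f.
move=> w; have [->|w0] := eqVneq w 0; first by exists 0.
by have [u uE] := cexp_surj w0; exists u.
Qed.

Lemma periodic_intr (T : Type) (H : R[i] -> T) (p : R[i]) :
  (forall w, H (w + p) = H w) -> forall (m : int) w, H (w + m%:~R * p) = H w.
Proof.
move=> Hp; have Hn (n : nat) w : H (w + n%:R * p) = H w.
  elim: n w => [|n IHn] w; first by rewrite mul0r addr0.
  by rewrite -addn1 natrD mulrDl mul1r addrA Hp.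
case=> n w; first exact: Hn.
by rewrite NegzE -[in RHS](subrK (n.+1%:R * p) w) Hn mulrNz mulNr.
Qed.

Lemma circleE c (r t : R) : 0 < r -> circle c r t = c + cexp (ln r +i* (2 * pi
  * t)).
Proof. by move=> r0; rewrite /cexp lnK ?posrE. Qed.

End Winding.

(** * Logarithms on a punctured disc *)

Section PuncturedDisc.
Variable R : realType.
Implicit Types (z w c : R[i]).

(* Here [H] is a logarithm of the pull-back of [g] by [w |-> c + exp w], and [g]
   has winding number 0 on one circle. *)
Lemma annulus_periodic (g : R[i] -> R[i]) c (r : R) (H : R[i] -> R[i]) :
    0 < r -> loop_winding (g \o circle c r) 0 ->
    (forall w, {for w, continuous H}) ->
    (forall w, Re w <= ln r -> cexp (H w) = g (c + cexp w)) ->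
    (forall w, cexp (H (w + (0 +i* (2 * pi)))) = cexp (H w)) ->
  forall w, H (w + (0 +i* (2 * pi))) = H w.
Proof.
move=> r0 wg cH HE Hp w; set p := 0 +i* _ in Hp *.
pose D z := H (z + p) - H z.
have D1 z : cexp (D z) = 1 by rewrite cexpD cexpN Hp divff ?cexp_neq0.
have cD z : {for z, continuous D}.
  have c1 : {for z, continuous (fun z => H (z + p))}.
    by apply: continuous_comp; [exact: continuous_addr|exact: cH].
  exact: continuous_fctD c1 (continuous_fctN (cH z)).
pose u t : R[i] := ln r +i* (2 * pi * t).
have cu t : {for t, continuous u}.
  have c2 : {for t, continuous (fun t : R => 2 * pi * t)}.
    exact: mulrl_continuous.
  exact: continuous_Complex (@cst_continuous _ _ (ln r) t) c2.
(* The segment from [u 0] to [u 1 = u 0 + p] parametrizes the circle, so [D (u 0)] is [2 i pi] times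
   the winding number of [g] on it, which is 0. *)
have Du : D (u 0) = 0.
  have [m Dm] := cexp_eq1 (D1 (u 0)).
  have wH : loop_winding (fun t => cexp (H (u t))) m.
    apply: loop_winding_cexp.
      by apply: continuous_subspaceT => t; apply: continuous_comp;
        [exact: cu|exact: cH].
    have -> : u 1 = u 0 + p.
      by rewrite /u /p; simpc; congr Complex; ring.
    by rewrite -raddfB -/(D _) Dm.
  have wg' : loop_winding (fun t => cexp (H (u t))) 0.
    apply: eq_loop_winding wg => t _.
    by rewrite /= circleE // HE.
  have m0 : m = 0.
    by apply: (loop_winding_unique _ wH wg') => t _; exact: cexp_neq0.
  by rewrite Dm m0 mulr0.
(* Since [D] is continuous with exponential 1 everywhere, it has equal values at the two ends of the
   segment from [u 0] to [w]. *)
suff : D (u 0) = D w by rewrite Du /D => /eqP; rewrite eq_sym subr_eq0 => /eqP.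
pose phi (t : R) := D (u 0 + t%:C * (w - u 0)).
have -> : D (u 0) = phi 0 by rewrite /phi mul0r addr0.
have -> : D w = phi 1 by rewrite /phi mul1r subrKC.
apply: cexp_eq1_const => [|t _]; last exact: D1.
have cl (t : R) : {for t, continuous (fun t : R => u 0 + t%:C * (w - u 0))}.
  apply: continuous_fctD; first exact: cst_continuous.
  apply: continuous_fctM; last exact: cst_continuous.
  exact: continuous_real_complex.
by apply: continuous_subspaceT => t; exact: (continuous_comp (cl t) (cD _)).
Qed.

(* The pull-back of [g] by [w |-> c + exp w] is made total by cutting [Re w] off
   at [ln r]. *)
Lemma punctured_disc_logarithm (g : R[i] -> R[i]) c (r : R) :
    0 < r -> loop_winding (g \o circle c r) 0 ->
    (forall z, 0 < normc (z - c) <= r -> {for z, continuous g} /\ g z != 0) ->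
  exists h : R[i] -> R[i], forall z, 0 < normc (z - c) < r ->
    {for z, continuous h} /\ g z = cexp (h z).
Proof.
move=> r0 wg gP.
pose q w : R[i] := c + cexp (Num.min (Re w) (ln r) +i* Im w).
have qc w : q w - c = cexp (Num.min (Re w) (ln r) +i* Im w).
  by rewrite /q addrC addKr.
have q_disc w : 0 < normc (q w - c) <= r.
  rewrite qc normc_cexp expR_gt0 /=.
  by apply: (@le_trans _ _ (expR (ln r)));
    rewrite ?ler_expR ?ge_min ?lexx ?orbT // lnK ?posrE.
have cq w : {for w, continuous q}.
  have c1 : {for w, continuous (fun w => Num.min (Re w) (ln r) +i* Im w)}.
    apply: continuous_Complex; last exact: continuous_Im.
    apply: (@continuous_min R _ (@complex.Re R) (fun=> ln r)).
      exact: continuous_Re.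
    exact: cst_continuous.
  have c2 := continuous_comp c1 (@continuous_cexp R _).
  exact: (continuous_fctD (@cst_continuous _ _ c w) c2).
have [||H cH HE] := @continuous_logarithm R (g \o q).
- by move=> w; apply: continuous_comp; [exact: cq|exact: (gP _ _).1].
- by move=> w; exact: (gP _ _).2.
have qE w : Re w <= ln r -> q w = c + cexp w.
  by case: w => x y; rewrite /q /= => /min_idPl->.
pose p : R[i] := 0 +i* (2 * pi).
have Hp w : H (w + p) = H w.
  apply: (annulus_periodic r0 wg cH) => {}w => [wr|].
    by rewrite -HE /= qE.
  rewrite -!HE /= /q; case: w => x y /=; rewrite addr0 /cexp /=.
  by rewrite cisD cis2pi mulr1.
have [f fP] := cexp_log_exists R.
(* By periodicity, [H] takes the same value at all logarithms of [z - c], so the arbitrary choice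
   [f] is harmless. *)
have hE z u : cexp u = z - c -> H (f (z - c)) = H u.
  move=> uE; have z0 : z - c != 0 by rewrite -uE cexp_neq0.
  have [m mE] : exists m : int, f (z - c) - u = 0 +i* (2 * pi * m%:~R).
    by apply: cexp_eq1; rewrite cexpD cexpN uE fP // divff.
  rewrite -(subrK u (f (z - c))) mE addrC -(periodic_intr Hp m u).
  congr (H (u + _)); rewrite /p -[m%:~R in RHS](rmorph_int (real_complex R)).
  by simpc; congr Complex; ring.
exists (fun z => H (f (z - c))) => z /andP[zc zr]; split; last first.
  have uE : cexp (f (z - c)) = z - c by rewrite fP // -normc_gt0.
  have Re_u : Re (f (z - c)) <= ln r.
    by rewrite -ler_expR -normc_cexp uE lnK ?posrE // ltW.
  by rewrite -HE /= qE // uE subrKC.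
have z0 : z - c != 0 by rewrite -normc_gt0.
(* For [w] near [z], [rho w] is near 1, and [f (z - c) + clog (rho w)] is a continuous local branch
   of the logarithm of [w - c] that may replace [f (w - c)]. *)
pose rho w := (w - c) / (z - c).
have crho : {for z, continuous rho}.
  exact: continuous_fctM (@continuous_addr _ (- c) z)
    (@cst_continuous _ _ (z - c)^-1 z).
have rhoz : rho z = 1 by rewrite /rho divff.
have near_rho : \forall w \near z, 0 < Re (rho w).
  have cRe := continuous_comp crho (@continuous_Re R _).
  by apply: (cvgr_gt _ cRe); rewrite /= rhoz ltr01.
have near_h : \forall w \near z, H (f (z - c) + clog (rho w)) = H (f (w - c)).
  near=> w; rewrite (hE w (f (z - c) + clog (rho w))) //.
  rewrite cexpD fP // clogK; last by near: w.
  by rewrite /rho mulrC divfK.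
apply: near_eq_continuous near_h _.
have clog_rho : {for rho z, continuous (@clog R)}.
  by apply: continuous_clog; rewrite rhoz ltr01.
have c2 := continuous_comp crho clog_rho.
have c1 := continuous_fctD (@cst_continuous _ _ (f (z - c)) z) c2.
exact: (continuous_comp c1 (cH _)).
Unshelve. all: by end_near. Qed.

End PuncturedDisc.

(** * Logarithms on the punctured plane *)

Section PuncturedPlane.
Variable R : realType.
Implicit Types (z w c : R[i]).

(** The logarithm on the punctured disc, multiplied by a cut-off function of the distance to [c],
    extends by 0 to the rest of the plane. *)
Lemma cutoff_logarithm (g : R[i] -> R[i]) c (r : R) :
    0 < r -> loop_winding (g \o circle c r) 0 ->
    (forall z, 0 < normc (z - c) <= r -> {for z, continuous g} /\ g z != 0) ->
  exists e : R[i] -> R[i], [/\ e c = 0,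
    (forall z, z != c -> {for z, continuous e}) &
    \forall z \near c, z != c -> cexp (e z) = g z].
Proof.
move=> r0 wg gP; have [h hP] := punctured_disc_logarithm r0 wg gP.
(* As a function of the distance to [c], [kappa] is 1 up to [r / 3], affine between [r / 3] and
   [2 r / 3], and 0 from there on. *)
pose kappa z : R := Num.max 0 (Num.min 1 (2 - 3 / r * normc (z - c))).
have cdist z : {for z, continuous (fun z => normc (z - c))}.
  exact: (continuous_comp (@continuous_addr R (- c) z) (@continuous_normc R _)).
have ckappa z : {for z, continuous kappa}.
  apply: (@continuous_max R _ (fun=> 0)); first exact: cst_continuous.
  apply: (@continuous_min R _ (fun=> 1)); first exact: cst_continuous.
  apply: continuousB; first exact: cst_continuous.
  apply: continuousM; [exact: cst_continuous|exact: cdist].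
exists (fun z => if z == c then 0 else (kappa z)%:C * h z); split.
- by rewrite eqxx.
- move=> z zc; have z0 : 0 < normc (z - c) by rewrite normc_gt0 subr_eq0.
  have near_c : \forall w \near z, 0 < normc (w - c).
    exact: (cvgr_gt _ (cdist z)).
  have [zr|rz] := ltP (normc (z - c)) r.
    have zdisc : 0 < normc (z - c) < r by rewrite z0 zr.
    have [ch _] := hP z zdisc.
    have ck := continuous_comp (ckappa z) (@continuous_real_complex R _).
    have near_e : \forall w \near z, (kappa w)%:C * h w =
        if w == c then 0 else (kappa w)%:C * h w.
      by apply: filterS near_c => w; rewrite normc_gt0 subr_eq0 => /negPf->.
    exact: near_eq_continuous near_e (continuous_fctM ck ch).
  have kz w : 2 / 3 * r < normc (w - c) -> kappa w = 0.
    move=> wr; apply: max_l; rewrite ge_min; apply/orP; right.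
    have -> : 3 / r * normc (w - c) = 2 + 3 / r * (normc (w - c) - 2 / 3 * r).
      by field; rewrite gt_eqF.
    by rewrite opprD addNKr oppr_le0 mulr_ge0 ?divr_ge0 ?subr_ge0 // ltW.
  have near_k : \forall w \near z, 0 = if w == c then 0 else (kappa w)%:C * h w.
    have : \forall w \near z, 2 / 3 * r < normc (w - c).
      by apply: (cvgr_gt _ (cdist z)); lra.
    by apply: filterS => w /kz->; rewrite mul0r if_same.
  exact: near_eq_continuous near_k (@cst_continuous _ _ 0 z).
- have : \forall z \near c, normc (z - c) < r / 3.
    apply: (cvgr_lt _ (cdist c)); rewrite subrr normc0; lra.
  apply: filterS => z zr zc; rewrite (negPf zc).
  have -> : kappa z = 1.
    rewrite /kappa min_l ?max_r ?ler01 //.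
    have -> : 3 / r * normc (z - c) = 1 - 3 / r * (r / 3 - normc (z - c)).
      by field; rewrite gt_eqF.
    suff : 0 <= 3 / r * (r / 3 - normc (z - c)) by lra.
    by rewrite mulr_ge0 ?divr_ge0 ?subr_ge0 // ltW.
  rewrite mul1r; have [|_ ->//] := hP z.
  by rewrite normc_gt0 subr_eq0 zc; lra.
Qed.

Section Punctures.
Variables (n : nat) (a : 'I_n -> R[i]).
Local Notation X := (punctured_plane a).

Lemma punctured_planeP z : X z <-> forall i, z != a i.
Proof.
split=> [Xz i|za [i _ ai]]; first by apply/eqP => zi; apply: Xz; exists i.
by have := za i; rewrite ai eqxx.
Qed.

Lemma open_neq c : open [set z : R[i] | z != c].
Proof.
rewrite openE => z /= zc.
have cdist : {for z, continuous (fun z => normc (z - c))}.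
  exact: (continuous_comp (@continuous_addr R (- c) z) (@continuous_normc R _)).
have : \forall w \near z, 0 < normc (w - c).
  by apply: (cvgr_gt _ cdist); rewrite normc_gt0 subr_eq0.
by apply: filterS => w; rewrite normc_gt0 subr_eq0.
Qed.

Lemma near_neq z c : z != c -> \forall w \near z, w != c.
Proof. by move=> zc; apply: (open_nbhs_nbhs (conj (@open_neq c) zc)). Qed.

Lemma near_punctured_plane z : X z -> \forall w \near z, X w.
Proof.
move=> /punctured_planeP Xz.
have : \forall w \near z, forall i, w != a i.
  by apply: (@filter_forall _ _ (fun i w => w != a i) (nbhs z) _) => i;
    exact: near_neq.
by apply: filterS => w /punctured_planeP.
Qed.

Lemma open_punctured_plane : open X.
Proof. by rewrite openE => z; exact: near_punctured_plane. Qed.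

Lemma punctured_plane_logarithm (g : R[i] -> R[i]) : injective a ->
    (forall z, X z -> {for z, continuous g} /\ g z != 0) ->
    (forall j, exists r : R, [/\ 0 < r,
      forall i, i != j -> r < normc (a i - a j) &
      loop_winding (g \o circle (a j) r) 0]) ->
  exists l : R[i] -> R[i], forall z, X z ->
    {for z, continuous l} /\ g z = cexp (l z).
Proof.
move=> a_inj gP wg.
have /choice[e eP] : forall j, exists e : R[i] -> R[i], [/\ e (a j) = 0,
    (forall z, z != a j -> {for z, continuous e}) &
    \forall z \near a j, z != a j -> cexp (e z) = g z].
  move=> j; have [r [r0 rP wr]] := wg j.
  apply: (cutoff_logarithm r0 wr) => z /andP[zj zr]; apply: gP.
  apply/punctured_planeP => i; have [->|ij] := eqVneq i j.
    by rewrite -subr_eq0 -normc_gt0.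
  by apply: contraTneq (rP _ ij) => <-; rewrite -leNgt.
pose E z := \sum_j e j z.
(* Near [a j], [g z] cancels against the factor [cexp (- e j z)]. *)
pose G z := if z \in X then g z * cexp (- E z) else cexp (- E z).
have cG z : {for z, continuous G}.
  have [Xz|] := pselect (X z).
    have cE : {for z, continuous E}.
      apply: continuous_sum => j _; have [_ + _] := eP j; apply.
      by have /punctured_planeP := Xz; apply.
    have c1 := continuous_comp (continuous_fctN cE) (@continuous_cexp R _).
    have c2 := continuous_fctM (gP z Xz).1 c1.
    have near_G : \forall w \near z, g w * cexp (- E w) = G w.
      by apply: filterS (near_punctured_plane Xz) => w Xw; rewrite /G mem_set.
    exact: near_eq_continuous near_G c2.
  move=> /contrapT[j _ <-].
  (* The other summands are continuous at [a j]. Near [a j], [G] is [cexp (- Ej)], including at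
     [a j] itself thanks to the convention [e j (a j) = 0]. *)
  pose Ej z := \sum_(i | i != j) e i z.
  have EE w : E w = e j w + Ej w by rewrite /E (bigD1 j).
  have cEj : {for a j, continuous Ej}.
    apply: continuous_sum => i ij; have [_ + _] := eP i; apply.
    by rewrite (inj_eq a_inj) eq_sym.
  have c1 := continuous_comp (continuous_fctN cEj) (@continuous_cexp R _).
  have [ej0 _ near_g] := eP j.
  have near_X : \forall w \near a j, forall i, i != j -> w != a i.
    apply: (@filter_forall _ _ (fun i w => i != j -> w != a i)
      (nbhs (a j)) _) => i.
    have [->|ij] := eqVneq i j; first exact: nearW.
    have := @near_neq (a j) (a i); rewrite (inj_eq a_inj) eq_sym => /(_ ij).
    by apply: filterS.
  have near_G : \forall w \near a j, cexp (- Ej w) = G w.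
    apply: filterS2 near_g near_X => w gw Xw; rewrite /G EE opprD cexpD.
    have [wj|wj] := eqVneq w (a j).
      rewrite wj ej0 oppr0 cexp0 mul1r memNset //.
      by move=> /punctured_planeP /(_ j); rewrite eqxx.
    rewrite mem_set ?cexpN -?gw ?mulVKf ?cexp_neq0 //.
    apply/punctured_planeP => i; have [->//|] := eqVneq i j; exact: Xw.
  exact: near_eq_continuous near_G c1.
have G0 z : G z != 0.
  rewrite /G; case: ifPn => [|_]; last exact: cexp_neq0.
  by rewrite inE => /gP[_ gz0]; rewrite mulf_neq0 ?cexp_neq0.
have [H cH HE] := continuous_logarithm cG G0.
exists (fun z => H z + E z) => z Xz; split.
  apply: continuous_fctD; first exact: cH.
  apply: continuous_sum => j _; have [_ + _] := eP j; apply.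
  by have /punctured_planeP := Xz; apply.
by rewrite cexpD -HE /G mem_set // -mulrA -cexpD addNr cexp0 mulr1.
Qed.

End Punctures.

End PuncturedPlane.

(** * From winding numbers to homotopies *)

Section Homotopy.
Variables (R : realType) (n : nat) (a : 'I_n -> R[i]).
Implicit Types (z w c : R[i]).
Local Notation X := (punctured_plane a).
Local Notation Y := (@CxCstar R).

Lemma continuous_map_open (f : R[i] -> R[i] * R[i]) : continuous_map X Y f ->
  forall z, X z -> {for z, continuous f} /\ (f z).2 != 0.
Proof.
move=> [Yf]; rewrite continuous_open_subspace; last exact: open_punctured_plane.
move=> cf z Xz; split; first by apply: cf; rewrite inE.
by have [_] := Yf z Xz.
Qed.

Lemma homotopic_cexp (f0 f : R[i] -> R[i] * R[i]) (l : R[i] -> R[i]) :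
    continuous_map X Y f0 -> continuous_map X Y f ->
    (forall z, X z -> {for z,
      continuous l} /\ (f0 z).2 / (f z).2 = cexp (l z)) ->
  homotopic R X Y f0 f.
Proof.
move=> mf0 mf lP.
have f0P := continuous_map_open mf0; have fP := continuous_map_open mf.
(* The first component moves along a segment; the second is a product of nonzero factors, equal to
   that of [f0] at time 0 and to that of [f] at time 1. *)
pose H1 (p : R * R[i]) := (f0 p.2).1 + p.1%:C * ((f p.2).1 - (f0 p.2).1).
pose H2 (p : R * R[i]) := (f p.2).2 * cexp ((1 - p.1)%:C * l p.2).
exists (fun p => (H1 p, H2 p)); split; first split.
- move=> [t z] [_ /= Xz]; split=> //=.
  by rewrite /Cstar /= mulf_neq0 ?cexp_neq0 // (fP _ Xz).2.
- apply: continuous_in_subspaceT => -[t z]; rewrite inE => -[_ /= Xz].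
  pose T := (R * R[i])%type.
  have c2 : {for (t, z), continuous (fun p : T => p.2)}
    by exact: snd_continuous.
  have c1 : {for (t, z), continuous (fun p : T => p.1)}
    by exact: fst_continuous.
  have cf0 : {for (t, z), continuous (fun p : T => f0 p.2)}.
    exact: (continuous_comp c2 (f0P z Xz).1).
  have cf : {for (t, z), continuous (fun p : T => f p.2)}.
    exact: (continuous_comp c2 (fP z Xz).1).
  have cf01 : {for (t, z), continuous (fun p : T => (f0 p.2).1)}.
    exact: (continuous_comp cf0 (@fst_continuous _ _ _)).
  have cf1 : {for (t, z), continuous (fun p : T => (f p.2).1)}.
    exact: (continuous_comp cf (@fst_continuous _ _ _)).
  have cf2 : {for (t, z), continuous (fun p : T => (f p.2).2)}.
    exact: (continuous_comp cf (@snd_continuous _ _ _)).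
  have cl : {for (t, z), continuous (fun p : T => l p.2)}.
    exact: (continuous_comp c2 (lP z Xz).1).
  have ct : {for (t, z), continuous (fun p : T => p.1%:C)}.
    exact: (continuous_comp c1 (@continuous_real_complex R _)).
  have ct1 : {for (t, z), continuous (fun p : T => (1 - p.1)%:C)}.
    have cB : {for (t, z), continuous (fun p : T => 1 - p.1)}.
      by apply: continuousB; [exact: cst_continuous|exact: c1].
    exact: (continuous_comp cB (@continuous_real_complex R _)).
  have cH1 := continuous_fctD cf01
    (continuous_fctM ct (continuous_fctD cf1 (continuous_fctN cf01))).
  have cH2 := continuous_fctM cf2
    (continuous_comp (continuous_fctM ct1 cl) (@continuous_cexp R _)).
  exact: cvg_pair cH1 cH2.
- move=> z Xz; rewrite /H1 /H2 /= mul0r addr0 subr0 mul1r -(lP z Xz).2.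
  by rewrite mulrC divfK ?(fP _ Xz).2 //; case: (f0 z).
- move=> z Xz; rewrite /H1 /H2 /= mul1r subrr mul0r cexp0 mulr1 subrKC.
  by case: (f z).
Qed.

(** With both winding numbers measured on the same circle, the quotient of the second components has
    winding number [m - m = 0] there, as [punctured_plane_logarithm] requires. *)
Lemma homotopic_of_winding (f0 f : R[i] -> R[i] * R[i]) : injective a ->
    continuous_map X Y f0 -> continuous_map X Y f ->
    (forall j, exists r (m : int), [/\ 0 < r,
      forall i, i != j -> r < normc (a i - a j),
      loop_winding (fun t => (f0 (circle (a j) r t)).2) m &
      loop_winding (fun t => (f (circle (a j) r t)).2) m]) ->
  homotopic R X Y f0 f.
Proof.
move=> a_inj mf0 mf wf.
have f0P := continuous_map_open mf0; have fP := continuous_map_open mf.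
have [||l lP] := @punctured_plane_logarithm R n a (fun z =>
  (f0 z).2 / (f z).2) a_inj.
- move=> z Xz; have [cf0 f00] := f0P z Xz; have [cf ff0] := fP z Xz.
  split; last by rewrite mulf_neq0 ?invr_eq0.
  have c1 : {for z, continuous (fun z => (f0 z).2)}.
    exact: (continuous_comp cf0 (@snd_continuous _ _ _)).
  have c2 : {for z, continuous (fun z => (f z).2)}.
    exact: (continuous_comp cf (@snd_continuous _ _ _)).
  exact: continuous_fctM c1 (@continuous_fctV _ _ z (fun z => (f z).2) ff0 c2).
- move=> j; have [r [m [r0 rP w0 w]]] := wf j; exists r; split => //.
  by have := loop_windingM w0 (loop_windingV w); rewrite subrr.
- exact: homotopic_cexp lP.
Qed.

Lemma continuous_circle c (r : R) (t : R) : {for t, continuous (circle c r)}.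
Proof.
have c1 : {for t, continuous (fun t : R => 2 * pi * t)}
  by exact: mulrl_continuous.
have c2 := continuous_comp c1 (@continuous_cis R _).
have c3 := continuous_fctM (@cst_continuous _ _ r%:C t) c2.
exact: continuous_fctD (@cst_continuous _ _ c t) c3.
Qed.

Lemma circle_dist c (r : R) t : 0 < r -> normc (circle c r t - c) = r.
Proof.
move=> r0; rewrite /circle addrC addKr -/(cis _) normcM normc_cis mulr1.
by rewrite normc_real ger0_norm // ltW.
Qed.

(** Since [b] lies outside the closed disc, [(circle c r t - b) / (c - b)] stays at distance less
    than 1 from 1, in the right half-plane; [clog] then gives a continuous logarithm with equal
    values at both ends. *)
Lemma loop_winding_circle_out c b (r : R) : 0 < r -> r < normc (b - c) ->
  loop_winding (fun t => circle c r t - b) 0.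
Proof.
move=> r0 rb; have cb : c - b != 0
  by rewrite -normc_gt0 normcB_sym (lt_trans r0).
have [d dE] := cexp_surj cb.
pose q t := (circle c r t - b) / (c - b).
have q1 t : 0 < Re (q t).
  have -> : q t = 1 + (circle c r t - c) / (c - b).
    by rewrite /q -[1 in RHS](divff cb) -mulrDl; congr (_ / _); ring.
  rewrite raddfD /= -ltrBlDl sub0r.
  have : normc ((circle c r t - c) / (c - b)) < 1.
    rewrite normcM normcV circle_dist // ltr_pdivrMr ?mul1r ?normc_gt0 //.
    by rewrite normcB_sym.
  move=> /(le_lt_trans (ler_normc_Re _)); rewrite ltr_norml => /andP[+ _].
  exact.
have cq t : {for t, continuous q}.
  have c1 : {for t, continuous (fun t => circle c r t - b)}.
    exact: continuous_comp (@continuous_circle c r t) (@continuous_addr R (- b)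
      _).
  exact: continuous_fctM c1 (@cst_continuous _ _ (c - b)^-1 t).
apply: (@eq_loop_winding _ (fun t => cexp (d + clog (q t)))).
  by move=> t _; rewrite cexpD dE clogK // mulrC divfK.
apply: loop_winding_cexp.
  apply: continuous_subspaceT => t.
  have c1 := continuous_comp (cq t) (continuous_clog (q1 t)).
  exact: continuous_fctD (@cst_continuous _ _ d t) c1.
by rewrite /q /circle mulr1 mulr0 -!/(cis _) cis2pi cis0 subrr.
Qed.

Lemma loop_winding_prod (I : Type) (s : seq I) (gamma : I -> R -> R[i]) (m : I
  -> int) :
  (forall i, loop_winding (gamma i) (m i)) ->
  loop_winding (fun t => \prod_(i <- s) gamma i t) (\sum_(i <- s) m i).
Proof.
move=> wg; elim: s => [|i s IHs].
  rewrite big_nil; apply: eq_loop_winding (loop_winding0 R).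
  by move=> t _; rewrite big_nil.
rewrite big_cons; apply: eq_loop_winding (loop_windingM (wg i) IHs).
by move=> t _; rewrite big_cons.
Qed.

End Homotopy.

(** * The embedding *)

Section DivisorFunction.
Variables (R : realType) (n : nat) (a : 'I_n -> R[i]).
Implicit Types (z w c : R[i]) (k : 'I_n -> int).
Local Notation X := (punctured_plane a).

Lemma differentiable_bigprod (I : Type) (s : seq I) (P : pred I)
    (F : I -> R[i] -> R[i]) z : (forall i, P i -> differentiable (F i) z) ->
  differentiable (fun w => \prod_(i <- s | P i) F i w) z.
Proof.
move=> dF; elim: s => [|i s IHs].
  under eq_fun do rewrite big_nil; exact: differentiable_cst.
under eq_fun do rewrite big_cons.
by have [Pi|_] := boolP (P i); [|exact: IHs];
  apply: (differentiableM (dF i Pi) IHs).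
Qed.

Lemma differentiable_bigsum (I : Type) (s : seq I) (P : pred I)
    (F : I -> R[i] -> R[i]) z : (forall i, P i -> differentiable (F i) z) ->
  differentiable (fun w => \sum_(i <- s | P i) F i w) z.
Proof.
move=> dF; elim: s => [|i s IHs].
  under eq_fun do rewrite big_nil; exact: differentiable_cst.
under eq_fun do rewrite big_cons.
by have [Pi|_] := boolP (P i); [|exact: IHs];
  apply: (differentiableD (dF i Pi) IHs).
Qed.

Lemma differentiable_subr c z : differentiable (fun w : R[i] => w - c) z.
Proof. by apply: differentiableB. Qed.

Lemma differentiable_exprz (k : int) c z : z != c ->
  differentiable (fun w : R[i] => (w - c) ^ k) z.
Proof.
move=> zc; have d1 := differentiable_subr c z.
have dX m : differentiable (fun w : R[i] => (w - c) ^+ m) z.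
  elim: m => [|m IHm]; first exact: differentiable_cst.
  by under eq_fun do rewrite exprS; exact: differentiableM d1 IHm.
case: k => m; first exact: dX.
by apply: (differentiableV (dX m.+1)); rewrite expf_neq0 // subr_eq0.
Qed.

Definition divisor_fun k z := \prod_(j < n) (z - a j) ^ k j.

Lemma divisor_fun_neq0 k z : X z -> divisor_fun k z != 0.
Proof.
move=> /punctured_planeP Xz; apply/prodf_neq0 => j _.
by rewrite expfz_neq0 // subr_eq0.
Qed.

Lemma divisor_funN k z : divisor_fun (fun j => - k j) z = (divisor_fun k z)^-1.
Proof.
by rewrite /divisor_fun -prodfV; apply: eq_bigr => j _; rewrite invr_expz.
Qed.

Lemma differentiable_divisor_fun k z : X z -> differentiable (divisor_fun k) z.
Proof.
move=> /punctured_planeP Xz.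
by apply: differentiable_bigprod => j _; exact: differentiable_exprz.
Qed.

(** The factor [z - a i] winds once around the circle if [i = j] and not at all otherwise, the other
    punctures being outside. *)
Lemma divisor_fun_winding k j (r : R) : 0 < r ->
    (forall i, i != j -> r < normc (a i - a j)) ->
  loop_winding (fun t => divisor_fun k (circle (a j) r t)) (k j).
Proof.
move=> r0 rP.
have -> : k j = \sum_(i < n) ((i == j)%:Z * k i).
  rewrite (bigD1 j) //= eqxx mul1r big1 ?addr0 // => i /negPf->.
  by rewrite mul0r.
apply: loop_winding_prod => i; apply: loop_windingX.
have [->|ij] := eqVneq i j; first exact: loop_winding_circle.
by apply: loop_winding_circle_out => //; exact: rP.
Qed.

Lemma near_inv_large (h : R[i] -> R[i]) c (M : R) :
    {for c, continuous h} -> h c = 0 ->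
  \forall z \near c, h z != 0 -> M < normc (h z)^-1.
Proof.
move=> ch hc0.
have M1 : 0 < `|M| + 1 by rewrite ltr_wpDl.
have : \forall z \near c, normc (h z) < (`|M| + 1)^-1.
  have cn := continuous_comp ch (@continuous_normc R _).
  by apply: (cvgr_lt _ cn); rewrite /= hc0 normc0 invr_gt0.
apply: filterS => z hz hz0; rewrite normcV.
apply: le_lt_trans (ler_norm M) _; apply: (@lt_trans _ _ (`|M| + 1)).
  by rewrite ltrDl.
by rewrite -(invrK (`|M| + 1)) ltf_pV2 // posrE ?invr_gt0 // normc_gt0.
Qed.

Lemma divisor_fun_zero k j (M : R) : injective a -> 0 < k j ->
  \forall z \near a j, X z -> M < normc (divisor_fun k z)^-1.
Proof.
move=> a_inj k0.
have c1 : {for a j, continuous (divisor_fun k)}.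
  apply: continuous_prod => i _.
  have [->|ij] := eqVneq i j.
    (* This factor vanishes at [a j], but its exponent is positive, so it is an ordinary power and
       continuous there too. *)
    case: (k j) k0 => [m|//] _.
    exact: (@continuous_exprn _ _ _ (fun z =>
      z - a j) m (@continuous_addr R (- a j) _)).
  apply: (@continuous_exprz _ _ _ (fun z => z - a i) (k i)).
    exact: continuous_addr.
  by rewrite subr_eq0 (inj_eq a_inj) eq_sym.
have c0 : divisor_fun k (a j) = 0.
  by rewrite /divisor_fun (bigD1 j) //= subrr exp0rz gt_eqF // mul0r.
apply: filterS (near_inv_large M c1 c0) => z h Xz; apply: h.
exact: divisor_fun_neq0.
Qed.

Lemma divisor_fun_infinity k (M : R) : 0 < \sum_j k j ->
  exists rho : R, forall z, X z -> rho < normc z -> M < normc (divisor_fun k z).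
Proof.
move=> k0.
(* [h u] is the inverse of [divisor_fun k (1 / u)], extended by 0 to [u = 0]. *)
pose h u := u ^ (\sum_j k j) * \prod_(j < n) (1 - a j * u) ^ (- k j).
have hE z : X z -> z != 0 -> h z^-1 = (divisor_fun k z)^-1.
  move=> /punctured_planeP Xz z0; rewrite /h /divisor_fun.
  have -> : z^-1 ^ (\sum_j k j) = \prod_(j < n) (z^-1 ^ k j).
    apply: (big_morph (fun m => z^-1 ^ m)) => // x y.
    by rewrite expfzDr ?invr_eq0.
  rewrite -big_split /= -prodfV; apply: eq_bigr => j _.
  have -> : 1 - a j * z^-1 = (z - a j) * z^-1 by rewrite mulrBl divff.
  have za : z - a j \is a GRing.unit by rewrite unitfE subr_eq0 Xz.
  have zu : z^-1 \is a GRing.unit by rewrite unitfE invr_eq0.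
  by rewrite -invr_expz exprzMl // invfM mulrCA mulfV ?mulr1 // expfz_neq0 //
    invr_eq0.
have c0 : h 0 = 0 by rewrite /h exp0rz gt_eqF // mul0r.
have ch : {for 0, continuous h}.
  case: (\sum_j k j) @h k0 {hE c0} => [m|//] h _.
  have c1 : {for 0, continuous (fun u : R[i] => u ^+ m)}.
    exact: (@continuous_exprn _ _ _ (fun u => u) m cvg_id).
  suff c2 : {for 0, continuous (fun u =>
    \prod_(j < n) (1 - a j * u) ^ (- k j))}.
    exact: continuous_fctM c1 c2.
  apply: continuous_prod => j _.
  apply: (@continuous_exprz _ _ _ (fun u => 1 - a j * u) (- k j)); last first.
    by rewrite mulr0 subr0 oner_neq0.
  have c2 : {for 0, continuous (fun u : R[i] => a j * u)}
    by exact: mulrl_continuous.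
  exact: continuous_fctD (@cst_continuous R[i] R[i] 1 0) (continuous_fctN c2).
have /nbhs_normP[_ /gt0_complexE[e e0 ->] eP] := near_inv_large M ch c0.
exists e^-1 => z Xz ez.
have zgt0 : 0 < normc z by apply: lt_trans ez; rewrite invr_gt0.
have z0 : z != 0 by rewrite -normc_gt0.
have := eP z^-1; rewrite /= hE // invrK; apply.
  rewrite sub0r normrN ltcR normcV -(invrK e).
  by rewrite ltf_pV2 // posrE invr_gt0.
by rewrite invr_eq0 divisor_fun_neq0.
Qed.

End DivisorFunction.

(** * Immersion and properness *)

Section Embedding.
Variables (R : realType) (n : nat) (a : 'I_n -> R[i]).
Implicit Types (z w c : R[i]) (k : 'I_n -> int).
Local Notation X := (punctured_plane a).
Local Notation Y := (@CxCstar R).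

Definition pole_fun (eps : R[i]) k z :=
  eps * z + \sum_(j < n | k j == 0) (z - a j)^-1.

Definition embedding_fun (eps : R[i]) k z :=
  (pole_fun eps k z, divisor_fun a k z).

Lemma differentiable_embedding_fun eps k z : X z ->
  differentiable (embedding_fun eps k) z.
Proof.
move=> Xz; have d2 := differentiable_divisor_fun k Xz.
suff d1 : differentiable (pole_fun eps k) z by exact: differentiable_pair d1 d2.
have d3 : differentiable (fun w => \sum_(j < n | k j == 0) (w - a j)^-1) z.
  apply: differentiable_bigsum => j _.
  apply: (differentiableV (@differentiable_subr R (a j) z)).
  by move/punctured_planeP : Xz; rewrite subr_eq0; exact.
have d4 : differentiable (fun w => eps * w) z.
  by apply: (@differentiableM R[i] R[i] (fun=> eps) (fun w => w)).
exact: differentiableD d4 d3.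
Qed.

Lemma continuous_embedding_fun eps k z : X z ->
  {for z, continuous (embedding_fun eps k)}.
Proof.
by move=> Xz; apply: differentiable_continuous;
  exact: differentiable_embedding_fun.
Qed.

(** By the chain rule, the differential of [phi] at [f z] is a left inverse of ['d f z]; this is
    checked on directional derivatives. *)
Lemma left_inverse_injective_diff (f : R[i] -> R[i] * R[i])
    (phi : R[i] * R[i] -> R[i]) z :
    differentiable f z -> differentiable phi (f z) ->
    (\forall w \near z, phi (f w) = w) -> injective ('d f z).
Proof.
move=> df dphi phif.
suff inj0 v : 'd f z v = 0 -> v = 0.
  by move=> u v /eqP; rewrite -subr_eq0 -linearB => /eqP/inj0/eqP;
    rewrite subr_eq0 => /eqP.
move=> fv; have dphif := differentiable_comp df dphi.
have [->//|v0] := eqVneq v 0.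
have : 'D_v (phi \o f) z = 'D_v id z by apply: near_eq_derive => //.
rewrite derive_id deriveE // diff_comp //= fv linear0 => <-//.
Qed.

(** Near [c], the modulus of [f] stays below [normc (f c) + 1], whereas that of [(z - c)^-1] exceeds
    any bound. *)
Lemma near_pole (f : R[i] -> R[i]) c (M : R) : {for c, continuous f} ->
  \forall z \near c, z != c -> M < normc ((z - c)^-1 + f z).
Proof.
move=> cf.
have cnf := continuous_comp cf (@continuous_normc R _).
have near_f : \forall z \near c, normc (f z) < normc (f c) + 1.
  by apply: (cvgr_lt _ cnf); rewrite /= ltrDl.
have near_i :=
  near_inv_large (M + (normc (f c) + 1)) (@continuous_addr R (- c) c) (subrr c).
apply: filterS2 near_f near_i => z fz iz zc.
have := iz; rewrite subr_eq0 => /(_ zc) {}iz.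
have : normc (z - c)^-1 <= normc ((z - c)^-1 + f z) + normc (f z).
  by rewrite -(normcN (f z)); apply: le_trans (le_normcD _ _); rewrite addrK.
lra.
Qed.

(** The alternatives are the three ways of leaving a compact subset of the target: the first
    component is large, the second is large, or the second is close to 0. The sign of [k j] decides
    which one occurs. *)
Lemma near_puncture eps k j (M : R) : injective a ->
  \forall z \near a j, X z -> [\/ M < normc (pole_fun eps k z),
    M < normc (divisor_fun a k z) | M < normc (divisor_fun a k z)^-1].
Proof.
move=> a_inj; have [kj|kj|kj] := ltgtP (k j) 0.
- have kj' : 0 < - k j by rewrite oppr_gt0.
  apply: filterS (@divisor_fun_zero R n a (fun j => - k j) j M a_inj kj') =>
    z h Xz; apply: Or32.
  by have := h Xz; rewrite divisor_funN invrK.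
- by apply: filterS (divisor_fun_zero M a_inj kj) => z h Xz; apply/Or33/h.
- pose g z := eps * z + \sum_(i < n | (k i == 0) && (i != j)) (z - a i)^-1.
  have cg : {for a j, continuous g}.
    have c1 : {for a j, continuous (fun z : R[i] => eps * z)}
      by exact: mulrl_continuous.
    have c2 : {for a j, continuous
        (fun z => \sum_(i < n | (k i == 0) && (i != j)) (z - a i)^-1)}.
      apply: continuous_sum => i /andP[_ ij].
      apply: (@continuous_fctV _ _ _ (fun z => z - a i)).
        by rewrite subr_eq0 (inj_eq a_inj) eq_sym.
      exact: continuous_addr.
    exact: continuous_fctD c1 c2.
  apply: filterS (near_pole M cg) => z h /punctured_planeP Xz; apply: Or31.
  suff -> : pole_fun eps k z = (z - a j)^-1 + g z by exact: h (Xz j).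
  by rewrite /pole_fun (bigD1 j) ?kj //= addrCA.
Qed.

(** If [eps = 1], the first component grows like [z]. Otherwise the second one behaves like a
    nonzero power of [z], whose sign decides between infinity and 0. *)
Lemma near_infinity (eps : R[i]) k (M : R) : eps = 1 \/ \sum_j k j != 0 ->
  exists rho : R, forall z, X z -> rho < normc z ->
    [\/ M < normc (pole_fun eps k z),
    M < normc (divisor_fun a k z) | M < normc (divisor_fun a k z)^-1].
Proof.
case=> [->|k0].
  (* Beyond [rho], every [z - a j] has modulus at least 1, so the sum of inverses has modulus at
     most [n], and what remains of [z] exceeds [M]. *)
  pose rho := `|M| + n%:R + 1 + \sum_j normc (a j).
  exists rho => z /punctured_planeP Xz zrho; apply: Or31.
  have sa0 : 0 <= \sum_j normc (a j) by apply: sumr_ge0 => j _;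
    exact: normc_ge0.
  have le1 j : normc (z - a j)^-1 <= 1.
    rewrite normcV invf_le1 ?normc_gt0 ?subr_eq0 //.
    have aj : normc (a j) <= \sum_j normc (a j).
      by rewrite (bigD1 j) //= lerDl; apply: sumr_ge0 => i _; exact: normc_ge0.
    have : normc z <= normc (z - a j) + normc (a j).
      by apply: le_trans (le_normcD _ _); rewrite subrK.
    have := normr_ge0 M; have : 0 <= n%:R :> R by [].
    move: zrho; rewrite /rho; lra.
  set S := \sum_(j < n | k j == 0) (z - a j)^-1.
  have SE : normc S <= n%:R.
    apply: (@le_trans _ _ (\sum_(j < n | k j == 0) normc (z - a j)^-1)).
      rewrite /S; elim/big_rec2: _ => [|j x y _ yx]; first by rewrite normc0.
      by apply: le_trans (le_normcD _ _) _; rewrite lerD2l.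
    apply: (@le_trans _ _ (\sum_(j < n) 1)); last first.
      by rewrite sumr_const card_ord.
    rewrite big_mkcond; apply: ler_sum => j _; case: ifP => // _.
  have : normc z <= normc (pole_fun 1 k z) + normc S.
    by rewrite -(normcN S); apply: le_trans (le_normcD _ _);
      rewrite /pole_fun mul1r addrK.
  have := ler_norm M; move: zrho; rewrite /rho; lra.
have [kneg|kpos] := ltP (\sum_j k j) 0.
  have kN : 0 < \sum_j - k j by rewrite sumrN oppr_gt0.
  have [rho rhoP] := divisor_fun_infinity a M kN.
  by exists rho => z Xz /(rhoP _ Xz); rewrite divisor_funN; exact: Or33.
have kP : 0 < \sum_j k j by rewrite lt_def k0.
have [rho rhoP] := divisor_fun_infinity a M kP.
by exists rho => z Xz /(rhoP _ Xz); exact: Or32.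
Qed.

Lemma compact_CxCstar_bounded (K : set (R[i] * R[i])) : compact K -> K `<=` Y ->
  exists M : R, forall p, K p ->
    [/\ normc p.1 <= M, normc p.2 <= M & normc p.2^-1 <= M].
Proof.
move=> Kc KY.
have bound (g : R[i] * R[i] -> R) : (forall p, K p -> {for p, continuous g}) ->
    exists M, forall p, K p -> g p <= M.
  move=> cg; have gK : compact (g @` K).
    apply: continuous_compact => //; apply: continuous_in_subspaceT => p.
    by rewrite inE; exact: cg.
  have [M [_ MP]] := compact_bounded (V := R^o) gK.
  exists (M + 1) => p Kp; apply: le_trans (ler_norm _) _.
  by apply: (MP (M + 1)); [rewrite ltrDl|exists p].
have [M1 M1P] := bound (fun p => normc p.1) (fun p _ =>
  continuous_comp (@fst_continuous _ _ p) (@continuous_normc R _)).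
have [M2 M2P] := bound (fun p => normc p.2) (fun p _ =>
  continuous_comp (@snd_continuous _ _ p) (@continuous_normc R _)).
have [|M3 M3P] := bound (fun p => normc p.2^-1).
  move=> p /KY[_ p0].
  have c1 := @continuous_fctV _ _ p (fun p => p.2) p0 (@snd_continuous _ _ p).
  exact: continuous_comp c1 (@continuous_normc R _).
exists (`|M1| + `|M2| + `|M3|) => p Kp.
have := M1P p Kp; have := M2P p Kp; have := M3P p Kp.
have := ler_norm M1; have := ler_norm M2; have := ler_norm M3.
have := normr_ge0 M1; have := normr_ge0 M2; have := normr_ge0 M3.
by split; lra.
Qed.

(** The preimage of [K] is bounded by [near_infinity]. It is closed in the whole plane: by
    [near_puncture] no puncture is a limit point, and elsewhere the map is continuous and [K]
    closed. *)
Lemma proper_embedding_fun eps k : injective a -> eps = 1 \/ \sum_j k j != 0 ->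
  proper_map X Y (embedding_fun eps k).
Proof.
move=> a_inj epsk K Kc KY.
have [M MP] := compact_CxCstar_bounded Kc KY.
have small z : K (embedding_fun eps k z) -> ~ [\/ M < normc (pole_fun eps k z),
    M < normc (divisor_fun a k z) | M < normc (divisor_fun a k z)^-1].
  by move=> /MP[/= m1 m2 m3] [] /lt_geF; rewrite ?m1 ?m2 ?m3.
have [rho rhoP] := near_infinity M epsk.
apply: (@closed_bounded_compact R _ rho); last first.
  move=> z [Xz /= Kz]; rewrite leNgt; apply/negP => /(rhoP z Xz).
  exact: small.
have Kcl : closed K by apply: compact_closed => //; exact: norm_hausdorff.
move=> z clz.
have Xz : X z.
  move=> [j _ ajz].
  move: clz; rewrite -ajz => /(_ _ (near_puncture eps k j M a_inj)).
  by move=> [w [[Xw /= Kw] /(_ Xw)]]; exact: small.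
split=> //=; apply: Kcl => B nB.
have [w [[Xw /= Kw] Bw]] := clz _ (@continuous_embedding_fun eps k z Xz B nB).
by exists (embedding_fun eps k w).
Qed.

End Embedding.

(** * Left inverses in the four cases *)

Section Existence.
Variables (R : realType) (n : nat) (a : 'I_n -> R[i]).
Implicit Types (z w c : R[i]) (k : 'I_n -> int).
Local Notation X := (punctured_plane a).
Local Notation Y := (@CxCstar R).

Lemma differentiable_fst (p : R[i] * R[i]) : differentiable (@fst R[i] R[i]) p.
Proof.
apply: linear_differentiable; exact: fst_continuous.
Qed.

Lemma differentiable_snd (p : R[i] * R[i]) : differentiable (@snd R[i] R[i]) p.
Proof.
apply: linear_differentiable; exact: snd_continuous.
Qed.

(** A holomorphic left inverse [phi] gives injectivity and the immersion property at once; the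
    condition on [eps] and [k] gives properness. *)
Lemma embedding_fun_embedding eps k (phi : R[i] * R[i] -> R[i]) :
    injective a -> eps = 1 \/ \sum_j k j != 0 ->
    (forall z, X z -> differentiable phi (embedding_fun a eps k z) /\
       phi (embedding_fun a eps k z) = z) ->
  embedding X Y (embedding_fun a eps k).
Proof.
move=> a_inj epsk phiP; split.
- by move=> z Xz; split => //; exact: divisor_fun_neq0.
- by move=> z; exact: differentiable_embedding_fun.
- move=> z Xz; apply: (left_inverse_injective_diff (phi := phi)).
  + exact: differentiable_embedding_fun.
  + exact: (phiP z Xz).1.
  + by apply: filterS (near_punctured_plane Xz) => w /phiP[].
- move=> z w /set_mem/phiP[_ {2}<-] /set_mem/phiP[_ {2}<-] ->//.
- exact: proper_embedding_fun.
Qed.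

Lemma exists_embedding_fun k : injective a ->
      (forall j, k j != 0)
      \/ [/\ (2 <= n)%N,
            (forall j : 'I_n, j = n.-1 :> nat -> k j = 0),
            (forall j : 'I_n, (j < n.-1)%N -> k j != 0) &
            \sum_(j < n | (j < n.-1)%N) k j != 0]
      \/ [/\ (3 <= n)%N,
            (forall j : 'I_n, (2 <= j)%N -> k j = 0),
            (forall j : 'I_n, j = 0%N :> nat -> k j = 1) &
            (forall j : 'I_n, j = 1%N :> nat -> k j = -1)]
      \/ [/\ (3 <= n)%N,
            (forall j : 'I_n, (1 <= j)%N -> k j = 0) &
            (forall j : 'I_n, j = 0%N :> nat -> k j = 1 \/ k j = -1)] ->
  exists eps, embedding X Y (embedding_fun a eps k).
Proof.
move=> a_inj [k0|[[n2 kn k0 sk]|[[n3 k0 k1 k2]|[n3 k0 k1]]]].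
(* No exponent vanishes, so the first component is [z] itself. *)
- exists 1; apply: (embedding_fun_embedding (phi := fst)) => //; first by left.
  move=> z Xz; split; first exact: differentiable_fst.
  by rewrite /= /pole_fun big_pred0 ?addr0 ?mul1r // => j; apply: negbTE.
(* Only the last exponent vanishes. With [eps = 0] the first component is [(z - a l)^-1], which
   determines [z]; properness comes from the nonzero sum of exponents. *)
- have n1 : (n.-1 < n)%N by rewrite prednK // (ltn_trans _ n2).
  pose l := Ordinal n1.
  have lE (j : 'I_n) : (j < n.-1)%N = (j != l).
    by rewrite ltn_neqAle -val_eqE /= -ltnS prednK ?ltn_ord ?andbT //
      (ltn_trans _ n2).
  have kE j : (k j == 0) = (j == l).
    have [->|jl] := eqVneq j l; first by rewrite kn.
    by apply/negbTE/k0; rewrite lE.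
  have E z : pole_fun a 0 k z = (z - a l)^-1.
    by rewrite /pole_fun mul0r add0r (big_pred1 l).
  exists 0; apply: (embedding_fun_embedding (phi :=
    fun w : R[i] * R[i] => a l + w.1^-1)) => //.
    by right; rewrite (bigD1 l) //= kn // add0r -(eq_bigl _ _ lE).
  move=> z /punctured_planeP Xz; have zl : (z - a l)^-1 != 0
    by rewrite invr_eq0 subr_eq0.
  split; last by rewrite /= E invrK subrKC.
  have d1 := differentiable_fst (embedding_fun a 0 k z).
  have d2 : differentiable (fun w : R[i] * R[i] =>
    w.1^-1) (embedding_fun a 0 k z).
    by apply: (differentiableV d1); rewrite /= E.
  exact: differentiableD (differentiable_cst (a l) _) d2.
(* The second component is the Moebius map [(z - a i0) / (z - a i1)], which [phi] inverts; it never
   takes the value 1 as [a i0] and [a i1] differ. The exponents sum to 0, hence [eps = 1]. *)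
- pose i0 := Ordinal (ltnW (ltnW n3)); pose i1 := Ordinal (ltnW n3).
  have i01 : i1 != i0 by [].
  have kE j : j != i0 -> j != i1 -> k j = 0.
    case: j => [[|[|j]] hj]; rewrite -!val_eqE //= => _ _; exact: k0.
  have E z : divisor_fun a k z = (z - a i0) / (z - a i1).
    rewrite /divisor_fun (bigD1 i0) //= (bigD1 i1) //= k1 // k2 // mulrA big1
      ?mulr1 //.
    by move=> j /andP[j0 j1]; rewrite kE.
  exists 1; apply: (embedding_fun_embedding
    (phi := fun w : R[i] * R[i] => (a i1 * w.2 - a i0) / (w.2 - 1))) => //;
      first by left.
  move=> z Xz; have za1 : z - a i1 != 0.
    by move/punctured_planeP : Xz; rewrite subr_eq0; exact.
  have a01 : a i1 - a i0 != 0 by rewrite subr_eq0 (inj_eq a_inj).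
  have D : divisor_fun a k z - 1 = (a i1 - a i0) / (z - a i1).
    by rewrite E; field.
  have D0 : divisor_fun a k z - 1 != 0 by rewrite D mulf_neq0 ?invr_eq0.
  split; last by rewrite /= D E; field; rewrite za1 a01.
  have d2 := differentiable_snd (embedding_fun a 1 k z).
  have d3 : differentiable (fun w : R[i] * R[i] => a i1 * w.2 - a i0)
      (embedding_fun a 1 k z).
    exact: differentiableB (differentiableM (differentiable_cst (a i1) _) d2)
      (differentiable_cst (a i0) _).
  have d4 : differentiable (fun w : R[i] * R[i] =>
    w.2 - 1) (embedding_fun a 1 k z).
    exact: differentiableB d2 (differentiable_cst (1 : R[i]) _).
  exact: differentiableM d3 (differentiableV d4 D0).
(* The second component is [z - a i0] or its inverse. As [k i0 * k i0 = 1], raising it to the power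
   [k i0] recovers [z - a i0]; the exponents sum to 1 or -1, so [eps = 0] is allowed. *)
- pose i0 := Ordinal (ltnW (ltnW n3)).
  have kE j : j != i0 -> k j = 0.
    case: j => [[|j] hj]; rewrite -!val_eqE //= => _; exact: k0.
  have kk : k i0 * k i0 = 1 by case: (k1 i0 erefl) => ->.
  have E z : divisor_fun a k z = (z - a i0) ^ k i0.
    rewrite /divisor_fun (bigD1 i0) //= big1 ?mulr1 //.
    by move=> j j0; rewrite kE.
  exists 0; apply: (embedding_fun_embedding (phi :=
    fun w : R[i] * R[i] => a i0 + (w.2 - 0) ^ k i0)) => //.
    right; rewrite (bigD1 i0) //= big1 ?addr0 //.
    by case: (k1 i0 erefl) => ->.
  move=> z Xz; split; last by rewrite /= E subr0 exprz_exp kk expr1z subrKC.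
  have d2 := differentiable_snd (embedding_fun a 0 k z).
  have d3 : differentiable (fun w : R[i] => (w - 0) ^ k i0) (divisor_fun a k z).
    by apply: differentiable_exprz; exact: divisor_fun_neq0.
  exact: differentiableD (differentiable_cst (a i0) _) (differentiable_comp d2
    d3).
Qed.

End Existence.

(* Indices run over 0, ..., n - 1, so a_1, a_2 and a_n have the indices of value
   0, 1 and n - 1. *)
Theorem theorem2 (R : realType) (n : nat) (a : 'I_n -> R[i])
    (f0 : R[i] -> R[i] * R[i]) (k : 'I_n -> int)
    (n_ge1 : (1 <= n)%N) (a_inj : injective a)
    (f0_map : continuous_map (punctured_plane a) (@CxCstar R) f0)
    (f0_winding : forall j, winding_about a f0 j (k j))
    (hk :
      (forall j, k j != 0)
      \/ [/\ (2 <= n)%N,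
            (forall j : 'I_n, j = n.-1 :> nat -> k j = 0),
            (forall j : 'I_n, (j < n.-1)%N -> k j != 0) &
            \sum_(j < n | (j < n.-1)%N) k j != 0]
      \/ [/\ (3 <= n)%N,
            (forall j : 'I_n, (2 <= j)%N -> k j = 0),
            (forall j : 'I_n, j = 0%N :> nat -> k j = 1) &
            (forall j : 'I_n, j = 1%N :> nat -> k j = -1)]
      \/ [/\ (3 <= n)%N,
            (forall j : 'I_n, (1 <= j)%N -> k j = 0) &
            (forall j : 'I_n, j = 0%N :> nat -> k j = 1 \/ k j = -1)]) :
  exists f : R[i] -> R[i] * R[i],
    embedding (punctured_plane a) (@CxCstar R) f /\
    homotopic R (punctured_plane a) (@CxCstar R) f0 f.
Proof.
have [eps emb] := exists_embedding_fun a_inj hk.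
exists (embedding_fun a eps k); split; first exact: emb.
apply: (homotopic_of_winding a_inj f0_map).
  split; first by have [] := emb.
  apply: continuous_in_subspaceT => z; rewrite inE.
  exact: continuous_embedding_fun.
(* The product has winding number [k j] on every circle about [a j] with the other punctures
   outside, in particular on the one where that of [f0] is given. *)
move=> j; have [r [r0 rP w0]] := f0_winding j; exists r, (k j).
have rP' i : i != j -> r < normc (a i - a j) by move=> /rP; rewrite ltcR.
by split; [exact: r0|exact: rP'|exact: w0|exact: divisor_fun_winding].
Qed.
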